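(* Let $G$ be a finite simple graph that is $(P_3\cup P_2,K_4)$-free. If $G$ contains an induced subgraph isomorphic to the co-domino or to the co-A, then $\chi(G)\le 7$.
   Context: $P_n$ is the path on $n$ vertices, $K_4$ the complete graph on $4$ vertices, $\cup$ disjoint union; ''free''/''contains'' refer to induced subgraphs; $\chi$ is the chromatic number. Let $C=u_1v_1v_2v_3u_3u_2$ be a $6$-cycle (edges $u_1v_1, v_1v_2, v_2v_3, v_3u_3, u_3u_2, u_2u_1$). The co-domino is the graph obtained from $C$ by adding the edges $v_1v_3$ and $u_1u_3$. The co-A is the graph obtained from $C$ by adding the edges $v_1v_3$, $u_1u_3$ and $u_1v_3$. *)

(* Defs.v *)
From mathcomp Require Import all_boot.
Set Implicit Arguments. Unset Strict Implicit. Unset Printing Implicit Defensive.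

Definition simple_graph (T : finType) (e : rel T) : Prop :=
  symmetric e /\ irreflexive e.

Definition edges_rel (n : nat) (E : seq (nat * nat)) : rel 'I_n :=
  fun i j => ((nat_of_ord i, nat_of_ord j) \in E) || ((nat_of_ord j, nat_of_ord i) \in E).

Definition contains_induced (T : finType) (e : rel T) (n : nat) (h : rel 'I_n) : Prop :=
  exists f : 'I_n -> T, injective f /\ forall i j, e (f i) (f j) = h i j.

Definition induced_free (T : finType) (e : rel T) (n : nat) (h : rel 'I_n) : Prop :=
  ~ contains_induced e h.

Definition P3uP2 : rel 'I_5 := @edges_rel 5 [:: (0,1); (1,2); (3,4)].
Definition K4 : rel 'I_4 := @edges_rel 4 [:: (0,1); (0,2); (0,3); (1,2); (1,3); (2,3)].
(* Vertex numbering: u1 = 0, v1 = 1, v2 = 2, v3 = 3, u3 = 4, u2 = 5.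
   6-cycle C = u1 v1 v2 v3 u3 u2. *)
Definition co_domino : rel 'I_6 :=
  @edges_rel 6 [:: (0,1); (1,2); (2,3); (3,4); (4,5); (5,0); (1,3); (0,4)].
Definition co_A : rel 'I_6 :=
  @edges_rel 6 [:: (0,1); (1,2); (2,3); (3,4); (4,5); (5,0); (1,3); (0,4); (0,3)].

Definition proper_coloring (T : finType) (e : rel T) (k : nat) (c : T -> 'I_k) : Prop :=
  forall x y, e x y -> c x != c y.
Definition colorable (T : finType) (e : rel T) (k : nat) : Prop :=
  exists c : T -> 'I_k, proper_coloring e c.

(* Main.v *)
Require Import Defs.
From mathcomp Require Import all_boot.

(* Fix the six vertices of an induced co-domino (or co-A) and sort the other vertices by their
   trace, i.e. their neighbourhood among the fixed vertices. Forbidding P3 u P2 and K4 leaves few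
   traces, and decides for most pairs of traces whether vertices carrying them may be adjacent; so
   7-colouring G reduces to 7-colouring a small graph on the traces. Where this fails, branch:
   either some trace (or some edge between two traces) does not occur, or a vertex (or the two ends
   of an edge) realising it joins the fixed vertices, which refines the traces. The two decision
   trees were found by computer search; that they prove the claim is a finite computation. *)

(** * Triangular adjacency rows and the search for forbidden subgraphs *)

(* A graph is encoded by strictly lower triangular rows: the row of a vertex lists its adjacency
   to the vertices after it. Vertices are fixed at the head, so a trace is a potential new row. *)
Fixpoint rows {V : Type} (r : rel V) (ws : seq V) : seq bitseq :=
  if ws is w :: ws' then [seq r w x | x <- ws'] :: rows r ws' else [::].

Lemma rows_map (U V : Type) (f : U -> V) (r : rel V) (us : seq U) :
  rows r (map f us) = rows (relpre f r) us.
Proof. by elim: us => //= u us ->; rewrite -map_comp. Qed.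

(** Reversing puts vertex 0 last, so the right fold of [initial_state] inserts it first. *)
Definition edge_rows (n : nat) (E : seq (nat * nat)) : seq bitseq :=
  rows (fun i j => ((i, j) \in E) || ((j, i) \in E)) (rev (iota 0 n)).

Fixpoint submx (m : bitseq) (g : seq bitseq) : seq bitseq :=
  match m, g with
  | b :: m', r :: g' => if b then mask m' r :: submx m' g' else submx m' g'
  | _, _ => [::]
  end.

Fixpoint masks (n k : nat) : seq bitseq :=
  match n, k with
  | _, 0 => [:: nseq n false]
  | 0, _.+1 => [::]
  | n'.+1, k'.+1 => map (cons true) (masks n' k') ++ map (cons false) (masks n' k)
  end.

(* Three edges on five vertices, none of them isolated, form P3 u P2. *)
Definition forbidden (g : seq bitseq) : bool :=
  match g with
  | [:: [:: a; b; c]; [:: p; q]; [:: s]; [::]] => [&& a, b, c, p, q & s]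
  | [:: [:: a; b; c; d]; [:: p; q; r]; [:: s; t]; [:: u]; [::]] =>
    [&& a + b + c + d + p + q + r + s + t + u == 3,
        [|| a, b, c | d], [|| a, p, q | r], [|| b, p, s | t],
        [|| c, q, s | u] & [|| d, r, t | u]]
  | _ => false
  end.

(* Only searches for copies that use the first [j] vertices. *)
Definition has_forbidden (j : nat) (g : seq bitseq) : bool :=
  has (fun k => has (fun m => forbidden (submx (nseq j true ++ m) g))
                    (masks (size g - j) (k - j))) [:: 4; 5].

(** * Certificates and their checker *)

(* [Vertex i] branches on whether the [i]-th trace occurs, [Edge i j] on whether there is an edge
   between the [i]-th and the [j]-th traces; the first subtree is the negative answer. The lists
   of a leaf are the colours of the fixed vertices and two colours for each trace, the second list
   being empty when it agrees with the first: a trace whose class induces a matching rather than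
   an independent set needs two colours. *)
Inductive cert : Type :=
| Leaf of seq nat & seq nat & seq nat
| Vertex of nat & cert & cert
| Edge of nat & nat & cert & cert.

(** [traces] over-approximates the traces that occur; [nonedges] collects the pairs assumed edgeless
    in negative [Edge] branches. *)
Record state := State {
  graph : seq bitseq;
  traces : seq bitseq;
  nonedges : seq (bitseq * bitseq) }.

(** Each old trace splits by adjacency to the new vertex. The prefix 2 restricts the search to
    copies through both the candidate and the new vertex; other copies show up at earlier
    insertions. *)
Definition add_vertex (t : bitseq) (s : state) : state :=
  State (t :: graph s)
    [seq bt <- [seq b :: t' | t' <- traces s, b <- [:: false; true]]
      | ~~ (head false bt && ((behead bt, t) \in nonedges s))
        && ~~ has_forbidden 2 (bt :: t :: graph s)]
    [seq (b.1 :: p.1, b.2 :: p.2) | p <- nonedges s,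
       b <- [:: (false, false); (false, true); (true, false); (true, true)]].

Definition forget_trace (t : bitseq) (s : state) : state :=
  State (graph s) [seq u <- traces s | u != t] (nonedges s).

Definition add_nonedge (t u : bitseq) (s : state) : state :=
  State (graph s) (traces s) [:: (t, u), (u, t) & nonedges s].

Definition may_be_adjacent (s : state) (t u : bitseq) : bool :=
  ((t, u) \notin nonedges s) && ~~ has_forbidden 2 ((true :: t) :: u :: graph s).

(** A class induces a matching when no vertex has two neighbours in it; [b] is the adjacency of two
    such neighbours, and both values must be refuted. *)
Definition matching_trace (s : state) (t : bitseq) : bool :=
  all (fun b => has_forbidden 3 ([:: true, true & t] :: (b :: t) :: t :: graph s))
      [:: false; true].

(* [if] instead of [||], since [vm_compute] would evaluate both disjuncts. *)
Definition compatible (s : state) (x y : bitseq * (nat * nat)) : bool :=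
  if [&& x.2.1 != y.2.1, x.2.1 != y.2.2, x.2.2 != y.2.1 & x.2.2 != y.2.2]
  then true else ~~ may_be_adjacent s x.1 y.1.

Definition self_compatible (s : state) (x : bitseq * (nat * nat)) : bool :=
  if x.2.1 != x.2.2 then matching_trace s x.1 else ~~ may_be_adjacent s x.1 x.1.

Fixpoint proper_graph (g : seq bitseq) (cs : seq nat) : bool :=
  match g, cs with
  | r :: g', c :: cs' => all (fun bd => bd.1 ==> (bd.2 != c)) (zip r cs') && proper_graph g' cs'
  | _, _ => true
  end.

Definition check_coloring (s : state) (cw c0 c1 : seq nat) : bool :=
  let typed := zip (traces s) (zip c0 c1) in
  [&& size cw == size (graph s), size c0 == size (traces s), size c1 == size (traces s),
      all (fun c => c < 7) (cw ++ c0 ++ c1), proper_graph (graph s) cw,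
      all (fun x => all (fun bd => bd.1 ==> (bd.2 != x.2.1) && (bd.2 != x.2.2)) (zip x.1 cw))
          typed,
      all (self_compatible s) typed & pairwise (compatible s) typed].

(** In the positive [Edge] branch the second end sees the first, whence [true :: u]. If that trace
    is already excluded, the edge cannot exist and the branch is vacuous. *)
Fixpoint check (c : cert) (s : state) : bool :=
  match c with
  | Leaf cw c0 c1 => check_coloring s cw c0 (if nilp c1 then c0 else c1)
  | Vertex i a b =>
    let t := nth [::] (traces s) i in
    check a (forget_trace t s) && check b (add_vertex t s)
  | Edge i j a b =>
    let t := nth [::] (traces s) i in
    let u := nth [::] (traces s) j in
    let s' := add_vertex t s in
    check a (add_nonedge t u s) &&
    (if (true :: u) \in traces s' then check b (add_vertex (true :: u) s') else true)
  end.

Definition initial_state g := foldr add_vertex (State [::] [:: [::]] [::]) g.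

(** * Correctness of the forbidden-subgraph test *)

(** Row [i] starts at vertex [i + 1], hence the offset. *)
Definition entry (g : seq bitseq) (i j : nat) : bool :=
  if i < j then nth false (nth [::] g i) (j - i.+1)
  else if j < i then nth false (nth [::] g j) (i - j.+1) else false.

(** Brute-force isomorphism test. Since [||] binds tighter than [==], the whole disjunction is the
    right-hand side. *)
Definition embeds (n : nat) (E : seq (nat * nat)) (g : seq bitseq) : bool :=
  has (fun p => all (fun i => all (fun j =>
         entry g (nth 0 p i) (nth 0 p j) == ((i, j) \in E) || ((j, i) \in E))
       (iota 0 n)) (iota 0 n)) (permutations (iota 0 n)).

(** With three edges and no isolated vertex, the five degrees must be 2, 1, 1, 1, 1, which forces P3
    u P2; here this is confirmed by running through all values of the ten bits. *)
Lemma forbidden_embeds g : forbidden g ->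
  (size g == 4) && embeds 4 [:: (0,1); (0,2); (0,3); (1,2); (1,3); (2,3)] g \/
  (size g == 5) && embeds 5 [:: (0,1); (1,2); (3,4)] g.
Proof.
rewrite /forbidden.
repeat match goal with
  |- context [match ?l with [::] => _ | _ :: _ => _ end] => case: l => [|? ?]; try done
end.
  by case/and5P=> -> -> -> -> /andP[-> ->]; left; vm_compute.
repeat match goal with b : bool |- _ => move: b end.
by do 10 case=> //; right; vm_compute.
Qed.

(** * States as true descriptions of G *)

Section Soundness.

Set Implicit Arguments. Unset Strict Implicit. Unset Printing Implicit Defensive.

Variables (T : finType) (e : rel T).
Hypotheses (e_sym : symmetric e) (e_irr : irreflexive e).

Definition trace (ws : seq T) (v : T) : bitseq := [seq e v w | w <- ws].

Local Notation gmat := (rows e).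

Lemma size_gmat ws : size (gmat ws) = size ws.
Proof. by elim: ws => //= w ws ->. Qed.

Lemma submx_gmat m ws : submx m (gmat ws) = gmat (mask m ws).
Proof.
elim: ws m => [|w ws IH] [|[] m] //=; rewrite IH // /trace.
by rewrite -map_mask.
Qed.

Lemma entry_gmat x0 ws i j : i < size ws -> j < size ws ->
  entry (gmat ws) i j = e (nth x0 ws i) (nth x0 ws j).
Proof.
elim: ws i j => [|w ws IH] [|i] [|j] //= Hi Hj; rewrite /entry /=.
- by rewrite subn1 /= (nth_map x0).
- by rewrite subn1 /= (nth_map x0) // e_sym.
- by rewrite !ltnS !subSS -IH.
Qed.

Lemma embeds_contains n E (x0 : T) ws : uniq ws -> size ws = n ->
  embeds n E (gmat ws) -> contains_induced e (@edges_rel n E).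
Proof.
move=> uw sw /hasP[p].
rewrite mem_permutations => pp /allP Hp.
have sp : size p = n by rewrite (perm_size pp) size_iota.
have up : uniq p by rewrite (perm_uniq pp) iota_uniq.
have lp i : i < n -> nth 0 p i < n.
  by move=> ltin; have : nth 0 p i \in p by [rewrite mem_nth ?sp];
     rewrite (perm_mem pp) mem_iota.
(* The permutation found by the search re-indexes [ws]. *)
exists (fun i : 'I_n => nth x0 ws (nth 0 p i)); split.
  move=> i j /eqP; rewrite nth_uniq ?sw ?lp // nth_uniq ?sp //.
  by move=> /eqP /val_inj.
move=> i j; rewrite -entry_gmat ?sw ?lp //.
have /allP/(_ (val j)) := Hp (val i) ltac:(by rewrite mem_iota /=).
by rewrite mem_iota /= => /(_ (ltn_ord j)) /eqP.
Qed.

Hypotheses (e_P3uP2 : induced_free e P3uP2) (e_K4 : induced_free e K4).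

Lemma forbidden_gmat ws : uniq ws -> ~~ forbidden (gmat ws).
Proof.
case: ws => // x0 ws uw; apply/negP => /forbidden_embeds []; rewrite size_gmat => /andP[/eqP sw].
- by move/(embeds_contains x0 uw sw)/e_K4.
- by move/(embeds_contains x0 uw sw)/e_P3uP2.
Qed.

(** Rows of actual vertices never trigger the test, so whatever it rejects does not occur in G. *)
Lemma has_forbidden_gmat j ws : uniq ws -> has_forbidden j (gmat ws) = false.
Proof.
move=> uw; apply/hasP => -[k _] /hasP[m _].
by rewrite submx_gmat (negbTE (forbidden_gmat (mask_uniq uw _))).
Qed.

(** The invariant carried down the tree. Traces are only included, not equal: a listed trace may
    have no vertex. *)
Record models (ws : seq T) (s : state) : Prop := Models {
  models_uniq : uniq ws;
  models_graph : gmat ws = graph s;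
  models_traces : forall v, v \notin ws -> trace ws v \in traces s;
  models_nonedges : forall x y, x \notin ws -> y \notin ws ->
    (trace ws x, trace ws y) \in nonedges s -> ~~ e x y }.

Lemma models_add_vertex ws s w : models ws s -> w \notin ws ->
  models (w :: ws) (add_vertex (trace ws w) s).
Proof.
case=> uw gw tw nw wws; split=> /=.
- by rewrite wws.
- by rewrite gw.
- move=> v; rewrite inE negb_or => /andP[vw vws].
  rewrite mem_filter; apply/andP; split; last first.
    apply/flatten_mapP; exists (trace ws v); rewrite ?tw // !inE.
    by case: (e v w); rewrite eqxx ?orbT.
  (* Candidate row, new row and old rows together are the rows of actual vertices of G. *)
  rewrite -gw -[_ :: _ :: gmat ws]/(gmat [:: v, w & ws]) has_forbidden_gmat ?andbT; last first.
    by rewrite /= inE negb_or vw vws wws.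
  by apply/negP => /= /andP[evw /nw]; rewrite evw => /(_ vws wws).
- move=> x y; rewrite !inE !negb_or => /andP[_ xws] /andP[_ yws].
  case/flatten_mapP => -[t u] pn; rewrite !inE.
  by case/or4P=> /eqP[_ tx _ ty]; apply: nw; rewrite // tx ty.
Qed.

Lemma models_initial_state ws : uniq ws -> models ws (initial_state (gmat ws)).
Proof.
elim: ws => [|w ws IH] /=; first by split.
by case/andP=> wws uw; apply: models_add_vertex => //; apply: IH.
Qed.

Lemma may_be_adjacentP ws s x y : models ws s -> x \notin ws -> y \notin ws -> e x y ->
  may_be_adjacent s (trace ws x) (trace ws y).
Proof.
move=> ms xws yws exy; have [uw gw tw nw] := ms.
apply/andP; split; first by apply: contraL exy => /nw ->.
rewrite -gw -exy -[_ :: _ :: gmat ws]/(gmat [:: x, y & ws]) has_forbidden_gmat //=.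
rewrite inE negb_or xws yws uw !andbT.
by apply: contraTneq exy => ->; rewrite e_irr.
Qed.

Lemma matching_traceP ws s t x y z : models ws s -> matching_trace s t ->
  x \notin ws -> y \notin ws -> z \notin ws -> uniq [:: x; y; z] ->
  trace ws x = t -> trace ws y = t -> trace ws z = t -> e x y -> e x z -> False.
Proof.
move=> ms /allP Ht xws yws zws uxyz tx ty tz exy exz; have [uw gw _ _] := ms.
(* The actual adjacency of [y] and [z] selects the case to refute. *)
have := Ht (e y z) ltac:(by case: (e y z)).
rewrite -gw -{1}exy -exz -{1}tx -{1}ty -tz.
rewrite -[X in has_forbidden _ X]/(gmat [:: x, y, z & ws]) has_forbidden_gmat //.
rewrite -[[:: x, y, z & ws]]/([:: x; y; z] ++ ws) uniq_catC cat_uniq uw uxyz /=.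
by rewrite (negbTE xws) (negbTE yws) (negbTE zws).
Qed.

(** * From the data of a leaf to a proper 7-colouring *)

(* On vertices sharing a trace whose class induces a matching, this bit separates the ends of
   each edge; on other classes its value is irrelevant. *)
Definition upper_end (ws : seq T) (v : T) : bool :=
  [exists w, [&& w \notin ws, e v w, trace ws w == trace ws v & enum_rank v < enum_rank w]].

(** The end of smaller rank gets [true], its partner being above it. A partner above the other end
    would be a second neighbour of that end in the class. *)
Lemma upper_endP ws s x y : models ws s -> matching_trace s (trace ws x) ->
  x \notin ws -> y \notin ws -> trace ws y = trace ws x -> e x y ->
  upper_end ws x != upper_end ws y.
Proof.
move=> ms; wlog ltxy: x y / enum_rank x < enum_rank y.
  move=> W mt xws yws txy exy.
  case: (ltngtP (enum_rank x) (enum_rank y)) => [lt|lt|/val_inj/enum_rank_inj eq].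
  - exact: W.
  - by rewrite eq_sym; apply: W; rewrite ?txy // e_sym.
  - by rewrite eq e_irr in exy.
move=> mt xws yws txy exy.
have -> : upper_end ws x by apply/existsP; exists y; rewrite yws exy txy eqxx.
rewrite eq_sym eqb_id; apply/existsP => -[z /and4P[zws eyz /eqP tzy ltyz]].
apply: (matching_traceP ms mt yws xws zws) => //; rewrite ?tzy // 1?e_sym //.
rewrite /= !inE negb_or.
apply/and3P; split=> //; last first.
  by apply: contraTneq (ltn_trans ltxy ltyz) => ->; rewrite ltnn.
apply/andP; split; first by apply: contraTneq exy => ->; rewrite e_irr.
by apply: contraTneq eyz => ->; rewrite e_irr.
Qed.

Lemma proper_graphP ws cs x y : proper_graph (gmat ws) cs -> size cs = size ws ->
  x \in ws -> y \in ws -> e x y -> nth 0 cs (index x ws) != nth 0 cs (index y ws).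
Proof.
elim: ws cs => [|w ws IH] [|c cs] //= /andP[/allP Hw pg] [sc].
(* Edges at the head vertex are read off the first row; all others are left to the induction. *)
have key v : v \in ws -> e w v -> nth 0 cs (index v ws) != c.
  move=> vws ewv; have iv : index v ws < size ws by rewrite index_mem.
  have /= := Hw (true, nth 0 cs (index v ws)); apply.
  have -> : (true, nth 0 cs (index v ws)) = nth (false, 0) (zip (trace ws w) cs) (index v ws).
    by rewrite nth_zip ?size_map // (nth_map w) // nth_index // ewv.
  by rewrite mem_nth // size_zip size_map sc minnn.
rewrite !inE ![w == _]eq_sym.
case: (eqVneq x w) => [->|xw] /=; case: (eqVneq y w) => [->|yw] //= xws yws exy.
- by rewrite e_irr in exy.
- by rewrite eq_sym; apply: key.
- by apply: key; rewrite // e_sym.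
- exact: IH.
Qed.

Lemma check_coloring_sound ws s cw c0 c1 :
  models ws s -> check_coloring s cw c0 c1 -> colorable e 7.
Proof.
move=> ms; have [uw gw tw _] := ms.
case/and5P=> /eqP scw /eqP sc0 /eqP sc1 lt7 /and4P[pg /allP Hw /allP Hself Hpair].
rewrite -gw size_gmat in scw; rewrite -gw in pg.
move: lt7; rewrite !all_cat => /and3P[lt_cw lt_c0 lt_c1].
set typed := zip _ _ in Hw Hself Hpair.
pose pos v := index (trace ws v) (traces s).
(* A vertex outside [ws] is coloured by its trace, the matching bit choosing between the two
   colours. *)
pose col v := if v \in ws then nth 0 cw (index v ws)
              else nth 0 (if upper_end ws v then c1 else c0) (pos v).
have st : size typed = size (traces s) by rewrite !size_zip sc0 sc1 !minnn.
pose x0 : bitseq * (nat * nat) := ([::], (0, 0)).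
have pos_lt v : v \notin ws -> pos v < size typed.
  by move=> vws; rewrite st index_mem tw.
have nth_typed v : v \notin ws ->
    nth x0 typed (pos v) = (trace ws v, (nth 0 c0 (pos v), nth 0 c1 (pos v))).
  move=> vws; rewrite nth_zip ?size_zip ?sc0 ?sc1 ?minnn // nth_zip ?sc0 ?sc1 //.
  by rewrite nth_index // tw.
have typed_in v : v \notin ws -> nth x0 typed (pos v) \in typed.
  by move=> /pos_lt; apply: mem_nth.
have col_lt v : col v < 7.
  rewrite /col; case: ifPn => [vws|/pos_lt].
    by apply: (allP lt_cw); rewrite mem_nth // scw index_mem.
  rewrite st => lt; case: (upper_end ws v).
    by apply: (allP lt_c1); rewrite mem_nth // sc1.
  by apply: (allP lt_c0); rewrite mem_nth // sc0.
have col_mixed x y : x \in ws -> y \notin ws -> e x y -> col x != col y.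
  move=> xws yws exy; rewrite /col xws (negbTE yws).
  have ix : index x ws < size ws by rewrite index_mem.
  have /= := Hw _ (typed_in _ yws); rewrite nth_typed //= => /allP H.
  have /= := H (true, nth 0 cw (index x ws)) _; case/(_ _)/andP.
    have -> : (true, nth 0 cw (index x ws)) = nth (false, 0) (zip (trace ws y) cw) (index x ws).
      by rewrite nth_zip ?size_map // (nth_map x) // nth_index // e_sym exy.
    by rewrite mem_nth // size_zip size_map scw minnn.
  by case: (upper_end ws y).
have col_lt_pos x y : x \notin ws -> y \notin ws -> e x y -> pos x < pos y -> col x != col y.
  move=> xws yws exy lt; rewrite /col (negbTE xws) (negbTE yws).
  have /(pairwiseP x0)/(_ (pos x) (pos y)) := Hpair.
  rewrite !inE !pos_lt // => /(_ isT isT lt).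
  rewrite !nth_typed // /compatible /= (may_be_adjacentP ms) //.
  by case: ifP => // /and4P[? ? ? ?] _; case: (upper_end ws x); case: (upper_end ws y).
exists (fun v => Ordinal (col_lt v)) => x y exy.
rewrite -val_eqE /=.
case: (boolP (x \in ws)) => xws; case: (boolP (y \in ws)) => yws.
- by rewrite /col xws yws; apply: proper_graphP.
- exact: col_mixed.
- by rewrite eq_sym; apply: col_mixed; rewrite // e_sym.
(* [pairwise] covers increasing positions only, so the reverse order goes by symmetry; equal
   positions mean equal traces. *)
case: (ltngtP (pos x) (pos y)) => [lt|lt|eqp].
- exact: col_lt_pos.
- by rewrite eq_sym; apply: col_lt_pos; rewrite // e_sym.
have txy : trace ws y = trace ws x.
  by have := nth_typed y yws; rewrite -eqp nth_typed // => -[].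
have := Hself _ (typed_in x xws); rewrite nth_typed // /self_compatible /=.
have := may_be_adjacentP ms xws yws exy; rewrite txy => ->.
case: ifP => // c01 mt; rewrite /col (negbTE xws) (negbTE yws) -eqp.
have := upper_endP ms mt xws yws txy exy.
by case: (upper_end ws x); case: (upper_end ws y) => // _; rewrite // eq_sym.
Qed.

(** G itself decides at each node which branch to follow, and the invariant survives the step. *)
Lemma check_sound c ws s : models ws s -> check c s -> colorable e 7.
Proof.
elim: c ws s => [cw c0 c1|i a IHa b IHb|i j a IHa b IHb] ws s ms /=.
- exact: check_coloring_sound ms.
- set t := nth _ _ _ => /andP[ca cb].
  have [uw gw tw nw] := ms.
  case: (pickP [pred v | (v \notin ws) && (trace ws v == t)]) => [v /andP[vws /eqP tv]|none].
    by apply: (IHb (v :: ws)) cb; rewrite -tv; apply: models_add_vertex.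
  apply: (IHa ws) ca; split=> //= v vws; rewrite mem_filter tw // andbT.
  by have := none v; rewrite /= vws => /negbT.
- set t := nth _ _ i; set u := nth _ _ j => /andP[ca cb].
  have [uw gw tw nw] := ms.
  case: (pickP [pred p | [&& p.1 \notin ws, p.2 \notin ws, e p.1 p.2,
                             trace ws p.1 == t & trace ws p.2 == u]]) => [[v w]|none].
    case/and5P=> /= vws wws evw /eqP tv /eqP tu.
    have ms1 := models_add_vertex ms vws; rewrite tv in ms1.
    have wvws : w \notin v :: ws.
      by rewrite inE negb_or wws andbT; apply: contraTneq evw => ->; rewrite e_irr.
    have tw1 : trace (v :: ws) w = true :: u by rewrite /= e_sym evw tu.
    have := models_add_vertex ms1 wvws; rewrite tw1 => ms2.
    (* [w] itself realises [true :: u], so the test for vacuity fails and [b] was checked. *)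
    by move: cb; have := models_traces ms1 wvws; rewrite tw1 => ->; apply: IHb ms2.
  apply: (IHa ws) ca; split=> //= x y xws yws; rewrite !inE => /or3P[|| /nw]; last exact.
    move=> /eqP[tx ty]; have := none (x, y).
    by rewrite /= xws yws tx ty !eqxx !andbT /= => ->.
  move=> /eqP[tx ty]; have := none (y, x).
  by rewrite /= xws yws tx ty !eqxx !andbT e_sym /= => ->.
Qed.

Lemma contains_colorable (n : nat) (E : seq (nat * nat)) (c : cert) :
  check c (initial_state (edge_rows n E)) ->
  contains_induced e (@edges_rel n E) -> colorable e 7.
Proof.
move=> chk [f [f_inj ef]].
(* Listing the embedded vertices in the reversed order of [edge_rows] gives literally the same
   rows. *)
have rowsE : gmat (map f (rev (enum 'I_n))) = edge_rows n E.
  rewrite /edge_rows -val_enum_ord -map_rev !rows_map; elim: (rev _) => //= i l ->.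
  by congr (_ :: _); apply: eq_map => j /=; rewrite ef.
have uf : uniq (map f (rev (enum 'I_n))) by rewrite map_inj_uniq // rev_uniq enum_uniq.
by apply: (check_sound (models_initial_state uf)); rewrite rowsE; exact: chk.
Qed.

End Soundness.

(** * The two certificates and the conclusion *)

(** Indices are positions in the trace list of the state reached at that node. Colours of fixed
    vertices are listed latest first, so the last six belong to the starting graph. *)
Definition co_domino_cert : cert :=
  Vertex 20
   (Vertex 17
    (Vertex 5
     (Vertex 1
      (Vertex 11
       (Vertex 2
        (Vertex 2
         (Vertex 14
          (Vertex 2
           (Vertex 4
            (Vertex 3
             (Vertex 9
              (Edge 2 4
               (Leaf [:: 0; 4; 5; 2; 1; 6] [:: 4; 4; 5; 4; 5; 2; 0; 3; 3; 0; 0]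
                 [:: 4; 4; 6; 4; 5; 1; 0; 3; 3; 0; 0])
               (Leaf [:: 4; 3; 2; 0; 1; 3; 6; 1] [:: 5; 5; 1; 6; 0; 6; 3; 1; 1;
                 4; 4; 4; 5; 0; 6; 2; 2; 2; 5; 0; 6; 2; 2; 2; 2; 2; 4] [::]))
              (Leaf [:: 3; 6; 1; 4; 1; 2; 0] [:: 4; 4; 4; 0; 5; 4; 0; 5; 1; 2; 6;
                2; 3; 6; 2; 3; 6; 6] [::]))
             (Vertex 15
              (Vertex 16
               (Edge 4 10
                (Leaf [:: 5; 6; 1; 2; 3; 4; 2] [:: 4; 0; 0; 5; 3; 0; 2; 2; 2; 4;
                  3; 6; 6; 1; 1; 6; 6; 6; 6] [::])
                (Leaf [:: 2; 4; 5; 0; 2; 3; 6; 0; 6] [:: 4; 4; 1; 5; 6; 6; 6; 5;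
                  1; 4; 1; 5; 3; 3; 6; 6; 6; 6; 5; 4; 5; 3; 1; 4; 1; 5; 2; 2; 1;
                  0; 0; 0; 1; 5; 2; 0; 0; 1; 4; 1; 5; 5; 3; 3] [::]))
               (Leaf [:: 6; 3; 0; 3; 4; 6; 5; 4] [:: 3; 4; 4; 4; 1; 2; 1; 2; 6;
                 2; 1; 2; 2; 3; 0; 5; 0; 0; 5; 0; 3; 5; 5; 5; 6; 6; 1] [::]))
              (Leaf [:: 1; 5; 4; 3; 2; 0; 1; 2] [:: 5; 3; 6; 2; 3; 3; 6; 2; 2; 2;
                5; 0; 4; 1; 4; 0; 4; 4] [::])))
            (Leaf [:: 1; 3; 2; 0; 1; 6; 0] [:: 6; 0; 0; 1; 3; 5; 5; 0; 4; 6; 2; 4;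
              3; 6; 2; 6; 5; 5; 4; 4] [::]))
           (Leaf [:: 4; 3; 5; 0; 5; 4; 6] [:: 4; 0; 0; 0; 6; 2; 3; 1; 5; 6; 0; 0; 6;
             4; 5; 2; 3; 1; 2; 1; 5; 2; 2; 3] [::]))
          (Leaf [:: 2; 5; 3; 0; 6; 5; 6] [:: 3; 3; 3; 3; 4; 4; 1; 6; 1; 6; 1; 6; 0; 0;
            2; 5; 2; 5; 4; 4; 5; 1; 2; 0; 2] [::]))
         (Vertex 8
          (Leaf [:: 2; 6; 5; 6; 4; 2; 3] [:: 5; 2; 0; 4; 1; 1; 1; 1; 6; 6; 2; 2; 4; 4;
            4; 5; 1; 6; 6] [:: 5; 2; 3; 4; 1; 1; 1; 1; 6; 6; 2; 2; 4; 4; 4; 5; 1; 6;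
            6])
          (Leaf [:: 4; 3; 4; 2; 5; 6; 0; 6] [:: 4; 2; 3; 3; 4; 6; 1; 1; 1; 5; 5; 5; 5;
            2; 0; 0; 0; 0; 3; 3; 0; 0; 1; 1; 1; 5; 5; 5; 5; 5; 5; 5] [::])))
        (Vertex 12
         (Leaf [:: 1; 5; 3; 2; 3; 5; 2] [:: 1; 0; 0; 0; 2; 1; 4; 4; 1; 6; 6; 5; 0; 0;
           0; 4; 4; 4; 4; 6; 6; 6] [:: 1; 0; 0; 0; 2; 1; 4; 4; 1; 6; 6; 3; 0; 0; 0; 4;
           4; 4; 4; 6; 6; 6])
         (Leaf [:: 1; 6; 2; 3; 6; 0; 4; 5] [:: 1; 6; 4; 4; 4; 4; 4; 2; 2; 0; 0; 0; 0;
           5; 1; 5; 5; 5; 1; 3; 6; 4; 3; 4; 3; 2; 0; 0; 3; 0; 2; 3; 1; 3; 2] [::])))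
       (Vertex 11
        (Vertex 7
         (Vertex 20
          (Vertex 14
           (Leaf [:: 0; 2; 4; 2; 4; 3; 5] [:: 0; 1; 3; 3; 3; 1; 5; 4; 0; 1; 1; 1; 1;
             6; 3; 6; 4; 0; 6; 6] [:: 0; 1; 3; 3; 3; 1; 2; 4; 0; 1; 1; 1; 1; 6; 3; 6;
             4; 0; 6; 6])
           (Leaf [:: 1; 3; 5; 2; 3; 5; 2; 6] [:: 1; 3; 6; 2; 2; 2; 6; 6; 6; 1; 5; 4;
             4; 4; 6; 6; 6; 6; 6; 6; 0; 0; 3; 2; 2; 0; 1; 4; 4; 0; 0] [::]))
          (Leaf [:: 4; 6; 1; 6; 2; 0; 3; 5] [:: 4; 6; 5; 3; 5; 3; 3; 5; 4; 0; 4; 0; 0;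
            4; 5; 5; 5; 5; 1; 1; 2; 2; 3; 3; 4; 4; 6; 1] [::]))
         (Leaf [:: 3; 3; 2; 6; 5; 6; 0; 1] [:: 3; 4; 0; 0; 0; 5; 6; 1; 1; 5; 2; 2; 4;
           0; 0; 2; 6; 3; 2; 5; 4; 2] [::]))
        (Leaf [:: 2; 1; 5; 2; 3; 6; 0; 6] [:: 0; 0; 4; 0; 4; 6; 2; 2; 6; 3; 3; 5; 1; 1;
          4; 4; 5; 4; 1; 5; 5; 3; 5] [::])))
      (Leaf [:: 0; 6; 2; 1; 0; 5; 0] [:: 1; 2; 1; 2; 3; 4; 2; 0; 2; 3; 5; 2; 4; 2; 2; 1;
        2; 1; 4] [:: 1; 2; 1; 2; 3; 4; 2; 0; 2; 3; 6; 2; 4; 2; 2; 1; 2; 1; 4]))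
     (Leaf [:: 1; 1; 2; 5; 0; 1; 0] [:: 1; 5; 5; 2; 3; 4; 6; 5; 5; 6; 5; 5; 2; 3; 2; 6; 2;
       5; 5] [:: 1; 5; 5; 2; 3; 0; 6; 5; 5; 6; 5; 5; 2; 3; 2; 6; 2; 5; 5]))
    (Leaf [:: 2; 0; 1; 2; 1; 6; 3] [:: 5; 3; 3; 3; 3; 5; 5; 5; 3; 0; 1; 3; 3; 3; 6; 4; 6; 4;
      5; 6; 4; 4] [:: 5; 3; 3; 3; 3; 5; 5; 5; 3; 2; 1; 3; 3; 3; 6; 4; 6; 4; 5; 6; 4; 4]))
   (Leaf [:: 6; 3; 1; 0; 5; 1; 5] [:: 5; 5; 5; 1; 4; 1; 4; 6; 4; 2; 2; 6; 2; 0; 0; 6; 1; 4;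
     1; 4; 0; 0] [:: 5; 5; 5; 1; 4; 1; 4; 6; 4; 2; 2; 6; 2; 0; 0; 3; 1; 4; 1; 4; 0; 0]).

(** All second colour lists are empty: at every leaf each trace class is independent. *)
Definition co_A_cert : cert :=
  Edge 10 22
   (Vertex 4
    (Vertex 3
     (Vertex 4
      (Vertex 24
       (Vertex 1
        (Vertex 12
         (Vertex 8
          (Edge 1 5
           (Leaf [:: 3; 1; 0; 2; 1; 6] [:: 6; 4; 6; 4; 4; 4; 5; 6; 2; 2; 2; 0; 0; 0;
             5; 1; 5; 3; 1; 5; 3; 0; 3] [::])
           (Vertex 16
            (Vertex 2
             (Vertex 20
              (Vertex 21
               (Leaf [:: 6; 0; 4; 0; 2; 3; 1; 6] [:: 3; 6; 6; 5; 5; 3; 3; 3; 3;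
                 3; 0; 6; 5; 5; 2; 2; 1; 1; 1; 0; 1; 4; 4; 4; 5; 3; 3; 4; 4; 4;
                 2; 2; 2; 2; 2; 2] [::])
               (Leaf [:: 2; 5; 4; 1; 2; 6; 3; 5; 3] [:: 3; 3; 5; 5; 5; 0; 0; 2;
                 4; 3; 2; 3; 3; 3; 0; 0; 2; 0; 0; 6; 6; 6; 4; 1; 1; 1; 5; 2; 4;
                 1; 2; 2; 1] [::]))
              (Leaf [:: 0; 2; 3; 1; 0; 5; 4; 3; 4] [:: 5; 2; 3; 3; 3; 5; 5; 2; 6;
                4; 4; 4; 4; 5; 6; 5; 6; 0; 6; 6; 1; 1; 1; 1; 1; 0; 5; 1; 1; 1; 5;
                2; 6; 6; 1; 1; 1; 1] [::]))
             (Vertex 5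
              (Vertex 15
               (Leaf [:: 3; 3; 5; 0; 5; 0; 4; 2; 6] [:: 4; 5; 5; 5; 3; 4; 4; 4;
                 4; 6; 6; 6; 6; 1; 3; 2; 2; 1; 1; 0; 0; 0; 0; 2; 2; 4; 4; 0; 0;
                 1; 1; 1; 0; 0; 0; 0; 0] [::])
               (Leaf [:: 4; 5; 5; 1; 0; 4; 0; 4; 3; 5] [:: 5; 3; 3; 3; 2; 1; 5;
                 1; 6; 5; 6; 6; 1; 5; 4; 6; 2; 2; 0; 0; 6; 3; 3; 2; 1; 0; 1; 2;
                 2; 0; 0; 0; 0] [::]))
              (Leaf [:: 6; 0; 2; 0; 3; 4; 5; 3; 6; 1] [:: 4; 2; 0; 6; 4; 5; 2; 5;
                1; 1; 1; 1; 0; 4; 3; 3; 2; 4; 4; 5; 5; 5; 5; 6; 2; 4; 5; 0; 5; 5;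
                5; 5] [::])))
            (Leaf [:: 6; 5; 4; 3; 1; 6; 1; 4; 0] [:: 3; 3; 4; 4; 4; 4; 4; 5; 1; 0;
              3; 0; 1; 5; 3; 5; 6; 6; 1; 3; 1; 1; 5; 2; 2; 3; 2; 2; 5; 5; 1; 3; 6;
              6; 6; 6; 3; 6] [::])))
          (Vertex 19
           (Vertex 23
            (Leaf [:: 6; 2; 5; 2; 3; 0; 1] [:: 5; 1; 4; 1; 4; 6; 4; 3; 3; 3; 6; 1;
              4; 6; 5; 0; 5; 5; 2; 0; 5; 2; 5; 2] [::])
            (Leaf [:: 4; 2; 3; 4; 2; 5; 6; 1] [:: 1; 2; 3; 6; 1; 1; 4; 3; 6; 0; 0;
              1; 1; 5; 5; 4; 3; 0; 0; 4; 1; 0; 2; 2; 3; 6; 2; 4; 3; 6; 4; 4; 3; 2;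
              4; 3] [::]))
           (Leaf [:: 3; 2; 4; 3; 0; 1; 3; 5] [:: 5; 4; 4; 4; 3; 4; 2; 5; 1; 1; 1; 2;
             5; 5; 4; 4; 2; 2; 0; 3; 6; 6; 3; 6; 0; 6; 6] [::])))
         (Leaf [:: 5; 4; 3; 4; 1; 2; 1] [:: 1; 1; 2; 2; 2; 2; 6; 6; 5; 3; 4; 2; 6; 4;
           3; 0] [::]))
        (Leaf [:: 0; 3; 4; 3; 2; 1; 2] [:: 3; 1; 6; 5; 2; 2; 5; 3; 4; 6; 0; 3; 4; 1; 4;
          0; 4; 6] [::]))
       (Leaf [:: 3; 4; 1; 5; 4; 2; 6] [:: 1; 5; 1; 2; 1; 2; 0; 2; 6; 6; 6; 6; 6; 0; 6; 3;
         3; 3; 4; 0; 2; 5; 2; 3; 3] [::]))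
      (Vertex 28
       (Vertex 13
        (Vertex 7
         (Vertex 9
          (Vertex 20
           (Leaf [:: 4; 0; 3; 0; 5; 3; 2] [:: 4; 6; 2; 6; 6; 6; 6; 2; 2; 4; 5; 5; 5;
             1; 4; 1; 1; 1; 4; 3; 0; 3; 3; 4; 0; 1; 1; 1; 1] [::])
           (Leaf [:: 6; 3; 5; 4; 0; 4; 1; 2] [:: 4; 5; 5; 3; 6; 3; 6; 5; 2; 6; 2; 2;
             2; 2; 3; 6; 3; 4; 1; 0; 6; 0; 6] [::]))
          (Leaf [:: 1; 1; 2; 3; 5; 3; 4; 6] [:: 6; 6; 4; 6; 6; 2; 6; 2; 1; 3; 3; 3; 2;
            1; 5; 5; 1; 0; 4; 4; 0; 0; 0; 0; 2; 5; 5; 5; 5; 5; 2] [::]))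
         (Leaf [:: 2; 4; 3; 5; 3; 2; 5; 1] [:: 2; 0; 1; 0; 1; 4; 1; 0; 6; 1; 4; 4; 6;
           4; 6; 2; 5; 3; 5; 5; 3; 6; 6; 6; 6] [::]))
        (Leaf [:: 4; 4; 3; 5; 6; 0; 1; 0] [:: 4; 5; 4; 5; 5; 6; 2; 6; 6; 0; 0; 0; 0; 2;
          6; 2; 3; 5; 1; 1; 1; 5; 1; 5; 6; 6; 2; 2; 2; 6] [::]))
       (Leaf [:: 0; 1; 6; 3; 2; 5; 4; 1] [:: 3; 6; 6; 3; 6; 6; 1; 1; 2; 1; 3; 3; 3; 5; 6;
         1; 1; 6; 3; 6; 1; 1; 5; 4; 0; 4; 0; 0; 2; 0; 0] [::])))
     (Leaf [:: 3; 4; 6; 0; 5; 4; 3] [:: 3; 2; 0; 3; 6; 1; 6; 0; 3; 6; 1; 2; 6; 0; 1; 4; 5;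
       6; 0; 6; 6; 0; 2; 2; 2; 6; 2; 0] [::]))
    (Leaf [:: 6; 2; 3; 4; 1; 3; 1] [:: 2; 0; 0; 2; 0; 2; 0; 0; 5; 2; 0; 1; 1; 0; 2; 4; 2; 4;
      0; 3; 6; 3; 3; 5; 5; 5; 4; 4; 4] [::]))
   (Vertex 20
    (Vertex 8
     (Leaf [:: 5; 0; 1; 0; 6; 4; 5; 4] [:: 1; 1; 1; 2; 2; 1; 2; 5; 4; 4; 4; 4; 4; 4; 3; 1;
       2; 3; 0; 6; 5; 6; 2; 3; 6] [::])
     (Leaf [:: 5; 0; 4; 2; 1; 3; 6; 0; 5] [:: 5; 1; 5; 4; 1; 5; 4; 4; 0; 0; 5; 6; 6; 6; 6;
       6; 6; 6; 6; 6; 6; 3; 3; 3; 3; 3; 4; 4; 2; 2; 0; 2; 2; 3; 3; 3; 2; 2] [::]))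
    (Leaf [:: 5; 3; 4; 5; 0; 6; 5; 1; 2] [:: 2; 0; 0; 1; 4; 4; 4; 2; 1; 5; 4; 2; 4; 3; 2; 2;
      2; 2; 4; 2; 6; 6; 6; 5; 0; 0; 3; 1; 3; 5; 6; 6; 6; 6] [::])).

Lemma co_domino_cert_valid :
  check co_domino_cert (initial_state (edge_rows 6
    [:: (0,1); (1,2); (2,3); (3,4); (4,5); (5,0); (1,3); (0,4)])).
Proof. by vm_compute. Qed.

Lemma co_A_cert_valid :
  check co_A_cert (initial_state (edge_rows 6
    [:: (0,1); (1,2); (2,3); (3,4); (4,5); (5,0); (1,3); (0,4); (0,3)])).
Proof. by vm_compute. Qed.

Theorem theorem1p2 (T : finType) (e : rel T) :
  simple_graph e ->
  induced_free e P3uP2 -> induced_free e K4 ->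
  contains_induced e co_domino \/ contains_induced e co_A ->
  colorable e 7.
Proof.
case=> e_sym e_irr e_P3uP2 e_K4 [has_co_domino | has_co_A].
- exact: (contains_colorable e_sym e_irr e_P3uP2 e_K4 co_domino_cert_valid has_co_domino).
- exact: (contains_colorable e_sym e_irr e_P3uP2 e_K4 co_A_cert_valid has_co_A).
Qed.
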